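(* Let $m\ge 2$ and $\tau\in S_m$. Let $n\ge 3$, $l\in\{2,\dots,n-1\}$ and $k\in\mathbb{N}$ with $k\ge 1$ and $k+l-1\le n$. (i) For every such $\tau$, $$P_n^{\mathrm{av}(\tau)}(A^{(n)}_{l;k})\le\frac{|S_{n-l+1}(\tau)|\,|S_l(\tau)|}{|S_n(\tau)|}.$$ (ii) If $\tau$ is cluster-free, then $$P_n^{\mathrm{av}(\tau)}(A^{(n)}_{l;k})=\frac{|S_{n-l+1}(\tau)|\,|S_l(\tau)|}{|S_n(\tau)|}.$$ (iii) If there is at least one of the two patterns $12$ and $21$ that $\tau$ does not contain tightly, then $$P_n^{\mathrm{av}(\tau)}(A^{(n)}_{l;k})\ge\frac{|S_{n-l+1}(\tau)|}{|S_n(\tau)|}.$$ If in fact $\tau$ contains tightly neither $12$ nor $21$, then $$P_n^{\mathrm{av}(\tau)}(A^{(n)}_{l;k})\ge\frac{2\,|S_{n-l+1}(\tau)|}{|S_n(\tau)|}.$$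
   Context: $S_n$ is the set of permutations of $[n]=\{1,\dots,n\}$, written $\sigma=\sigma_1\sigma_2\cdots\sigma_n$. For $l\in\{2,\dots,n-1\}$ and $k\ge1$ with $k+l-1\le n$, $A^{(n)}_{l;k}\subset S_n$ is the set of $\sigma\in S_n$ for which there exists $a$ with $\{k,k+1,\dots,k+l-1\}=\{\sigma_a,\sigma_{a+1},\dots,\sigma_{a+l-1}\}$. For $\tau\in S_m$ with $2\le m\le n$, $\sigma\in S_n$ contains $\tau$ as a pattern if there are indices $1\le i_1<\cdots<i_m\le n$ such that for all $1\le j,j'\le m$, $\sigma_{i_j}<\sigma_{i_{j'}}$ if and only if $\tau_j<\tau_{j'}$; otherwise $\sigma$ avoids $\tau$. $S_n(\tau)$ is the set of $\sigma\in S_n$ avoiding $\tau$; if $n<m$, $S_n(\tau)=S_n$. $P_n^{\mathrm{av}(\tau)}$ is the uniform probability measure on $S_n(\tau)$, so $P_n^{\mathrm{av}(\tau)}(A)=|A\cap S_n(\tau)|/|S_n(\tau)|$ for $A\subset S_n$. $\tau\in S_m$ contains $12$ tightly if for some $i,h$ one has $\tau_i=h$ and $\tau_{i+1}=h+1$; it contains $21$ tightly if for some $i,h$ one has $\tau_i=h+1$ and $\tau_{i+1}=h$. $\tau\in S_m$ is cluster-free if $\tau\notin A^{(m)}_{l';k'}$ for all $l'\in\{2,\dots,m-1\}$ and all $k'\in\mathbb{N}$, $k'\ge1$, with $k'+l'-1\le m$. *)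

(* Defs.v *)
(* A permutation of [n] = {1, ..., n} is an element of 'S_n, a
   permutation of 'I_n = {0, ..., n-1}: positions and values are both shifted
   down by one, so that the one-line letter sigma_(i+1) is (s i).+1. *)
From HB Require Import structures.
From mathcomp Require Import all_boot all_order all_algebra all_fingroup.

Set Implicit Arguments.
Unset Strict Implicit.
Unset Printing Implicit Defensive.

Import Order.TTheory GRing.Theory Num.Theory.

(* The event A^(n)_(l;k).  The window occupies the 0-based positions
   a, ..., a + l - 1; k and the block {k, ..., k + l - 1} are 1-based, hence the
   shift j.+1 on values. *)
Definition clustered (n l k : nat) : {set 'S_n} :=
  [set s : 'S_n | [exists a : 'I_n, (a + l <= n) &&
     ([set j : 'I_n | k <= j.+1 <= k + l - 1] ==
      [set s i | i : 'I_n & a <= i < a + l])]].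

Definition contains (m n : nat) (t : 'S_m) (s : 'S_n) : bool :=
  [exists f : {ffun 'I_m -> 'I_n},
     [forall j : 'I_m, forall j' : 'I_m, (j < j') ==> (f j < f j')] &&
     [forall j : 'I_m, forall j' : 'I_m, (s (f j) < s (f j')) == (t j < t j')]].

(* This is all of 'S_n when n < m, see avoidersT below. *)
Definition avoiders (m : nat) (t : 'S_m) (n : nat) : {set 'S_n} :=
  [set s : 'S_n | ~~ contains t s].

Lemma avoidersT (m n : nat) (t : 'S_m) : n < m -> avoiders t n = [set: 'S_n].
Proof.
move=> ltnm; apply/setP=> s; rewrite !inE; apply/negP.
case/existsP=> f /andP[/forallP fP _].
have f_inj : injective f.
  move=> x y fxy; apply/val_inj/eqP; case: ltngtP => // lt_xy.
    by have /forallP/(_ y)/implyP/(_ lt_xy) := fP x; rewrite fxy ltnn.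
  by have /forallP/(_ x)/implyP/(_ lt_xy) := fP y; rewrite fxy ltnn.
by have := leq_card f f_inj; rewrite !card_ord leqNgt ltnm.
Qed.

Definition Pav (m : nat) (t : 'S_m) (n : nat) (A : {set 'S_n}) : rat :=
  (#|A :&: avoiders t n|%:R / #|avoiders t n|%:R)%R.

Definition tight12 (m : nat) (t : 'S_m) : bool :=
  [exists i : 'I_m, exists i' : 'I_m,
     (i' == i.+1 :> nat) && (t i' == (t i).+1 :> nat)].

Definition tight21 (m : nat) (t : 'S_m) : bool :=
  [exists i : 'I_m, exists i' : 'I_m,
     (i' == i.+1 :> nat) && (t i == (t i').+1 :> nat)].

Definition cluster_free (m : nat) (t : 'S_m) : Prop :=
  forall l k : nat, 2 <= l <= m - 1 -> 1 <= k -> k + l - 1 <= m ->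
    t \notin clustered m l k.

(* Main.v *)
(* Collapsing the window of a clustered permutation s to one letter gives a
   permutation rho of [n - l + 1], and standardizing the window gives a
   permutation pi of [l]; since the value k determines where the window sits,
   s |-> (rho, pi) is a bijection from A_(l;k) onto all pairs.  If s avoids t,
   so do rho and pi, which is (i).  Conversely, an occurrence of t in s lies in
   the window, or has at most one letter there and so is an occurrence in rho,
   or else its letters in the window form a cluster of t, whence (ii).  When pi
   is the identity (resp. the reversal), two letters of the occurrence in the
   window already force t to contain 12 (resp. 21) tightly, whence (iii). *)
Require Import Defs.
From HB Require Import structures.
From mathcomp Require Import all_boot all_order all_algebra all_fingroup.
From mathcomp Require Import zify.
Import Order.TTheory GRing.Theory Num.Theory.

Set Implicit Arguments.
Unset Strict Implicit.
Unset Printing Implicit Defensive.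

(* The extension of s to all of nat by the identity, still a bijection. *)
Definition ext (n : nat) (s : 'S_n) (x : nat) : nat :=
  oapp (fun i : 'I_n => nat_of_ord (s i)) x (insub x).

(** * Permutations and pattern occurrences as functions on [nat] *)

Section Extension.

Variables (n : nat).
Implicit Types (s : 'S_n) (x y : nat).

Lemma ext_ord s (i : 'I_n) : ext s i = s i.
Proof. by rewrite /ext valK. Qed.

Lemma ext_out s x : n <= x -> ext s x = x.
Proof. by move=> nx; rewrite /ext insubF // ltnNge nx. Qed.

Lemma ext_lt s x : (ext s x < n) = (x < n).
Proof.
case: (ltnP x n) => [lxn | nx]; last by rewrite ext_out // ltnNge nx.
by rewrite -[x]/(val (Ordinal lxn)) ext_ord ltn_ord.
Qed.

Lemma extK s : cancel (ext s) (ext s^-1).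
Proof.
move=> x; case: (ltnP x n) => [lxn | nx]; last by rewrite !ext_out.
by rewrite -[x]/(val (Ordinal lxn)) !ext_ord permK.
Qed.

Lemma extKV s : cancel (ext s^-1) (ext s).
Proof. by move=> x; rewrite -{1}[s]invgK extK. Qed.

Lemma ext_inj s : injective (ext s).
Proof. exact: can_inj (extK s). Qed.

Lemma eq_ext s s' : (forall x, x < n -> ext s x = ext s' x) -> s = s'.
Proof.
by move=> ss'; apply/permP=> i; apply/val_inj; rewrite /= -!ext_ord ss'.
Qed.

(** An injective self-map of a finite set is bijective, so the permutations built below need no
    surjectivity check. *)
Lemma ext_exists (f : nat -> nat) :
    (forall x, x < n -> f x < n) ->
    (forall x y, x < n -> y < n -> f x = f y -> x = y) ->
  exists s, forall x, x < n -> ext s x = f x.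
Proof.
move=> f_lt f_inj; pose g (i : 'I_n) := Ordinal (f_lt i (ltn_ord i)).
have g_inj : injective g.
  by move=> i j [] /f_inj ij; apply/val_inj/ij.
exists (perm g_inj) => x lxn.
by rewrite -[x in LHS]/(val (Ordinal lxn)) ext_ord permE.
Qed.

(** With [k = b.+1] the block becomes the 0-based interval from [b] to [b + l - 1]. Since [l] is
    positive, the window is nonempty and its start is an element of ['I_n]. *)
Lemma clusteredP l b s : 0 < l ->
  reflect (exists2 a, a + l <= n &
             forall x, x < n -> (b <= ext s x < b + l) = (a <= x < a + l))
          (s \in clustered n l b.+1).
Proof.
move=> l_gt0; rewrite inE.
have memE (a : nat) (i : 'I_n) :
    (s i \in [set s j | j : 'I_n & a <= j < a + l]) = (a <= i < a + l).
  by rewrite mem_imset ?inE //; apply: perm_inj.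
apply: (iffP existsP) => [[a /andP[al_n /eqP/setP sE]] | [a al_n sE]].
  exists a => // x lxn; have := sE (s (Ordinal lxn)).
  by rewrite memE inE -(ext_ord s) /= => <-; lia.
have lan : a < n by lia.
exists (Ordinal lan); rewrite al_n; apply/eqP/setP=> j.
rewrite -(permKV s j) memE inE -(ext_ord s) /= -sE //; lia.
Qed.

(** Positions are taken in [nat] so that an occurrence can be moved between permutations of
    different sizes by plain arithmetic. *)
Lemma containsP m (t : 'S_m) s :
  reflect (exists f : 'I_m -> nat,
             [/\ forall j, f j < n,
                 forall j j' : 'I_m, j < j' -> f j < f j' &
                 forall j j', (ext s (f j) < ext s (f j')) = (t j < t j')])
          (contains t s).
Proof.
apply: (iffP existsP) => [[f /andP[/forallP fP /forallP sP]] | [f [f_lt fP sP]]].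
  exists (fun j => nat_of_ord (f j)); split=> [j|j j' jj'|j j'] //.
    by have /forallP/(_ j')/implyP/(_ jj') := fP j.
  by rewrite !ext_ord; have /forallP/(_ j')/eqP := sP j.
exists [ffun j => Ordinal (f_lt j)]; apply/andP; split.
  by apply/'forall_forallP=> j j'; rewrite !ffunE; apply/implyP/fP.
by apply/'forall_forallP=> j j'; rewrite !ffunE -sP -!(ext_ord s).
Qed.

End Extension.

Lemma ext1 n x : ext (1%g : 'S_n) x = x.
Proof.
case: (ltnP x n) => [lx | ?]; last by rewrite ext_out.
by rewrite -[x in LHS]/(val (Ordinal lx)) ext_ord perm1.
Qed.

Definition rev_perm (n : nat) : 'S_n := perm (@rev_ord_inj n).

Lemma ext_rev n x : x < n -> ext (rev_perm n) x = n - x.+1.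
Proof.
by move=> lx; rewrite -[x in LHS]/(val (Ordinal lx)) ext_ord permE.
Qed.

Lemma rev_perm_neq1 n : 1 < n -> 1%g != rev_perm n.
Proof.
move=> n_gt1; apply/eqP=> /(congr1 (fun u => ext u 0)).
by rewrite ext1 ext_rev; lia.
Qed.

(** * Convex sets of indices are intervals *)

Lemma convex_set m (J : {set 'I_m}) : J != set0 ->
    (forall i j h : 'I_m, i \in J -> h \in J -> i <= j <= h -> j \in J) ->
  exists2 p, p + #|J| <= m & forall i : 'I_m, (i \in J) = (p <= i < p + #|J|).
Proof.
case/set0Pn=> i0 i0J Jconv.
pose p := [arg min_(i < i0 in J) nat_of_ord i].
pose q := [arg max_(i > i0 in J) nat_of_ord i].
have [pJ pP] : p \in J /\ forall i, i \in J -> p <= i.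
  by rewrite /p; case: arg_minnP.
have [qJ qP] : q \in J /\ forall i, i \in J -> i <= q.
  by rewrite /q; case: arg_maxnP.
have JE i : (i \in J) = (p <= i <= q).
  by apply/idP/idP=> [iJ|/(Jconv _ _ _ pJ qJ)//]; rewrite pP ?qP.
have pq := pP _ qJ; have lqm := ltn_ord q.
suff cJ : #|J| = (q - p).+1.
  by exists (nat_of_ord p) => [|i]; rewrite ?JE cJ; lia.
have lt_pm (y : 'I_(q - p).+1) : p + y < m by have := ltn_ord y; lia.
have g_inj : injective (fun y => Ordinal (lt_pm y)).
  by move=> y z [] yz; apply/val_inj; rewrite /=; lia.
rewrite -[RHS]card_ord -(card_imset predT g_inj); apply: eq_card => i.
rewrite JE; apply/idP/imsetP=> [piq | [y _ ->] /=].
  have lty : i - p < (q - p).+1 by lia.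
  by exists (Ordinal lty) => //; apply/val_inj; rewrite /=; lia.
by have := ltn_ord y; lia.
Qed.

(** * Inflation of one letter to a block *)

Section Inflation.

Variables (n l N b : nat).
Hypotheses (l_gt0 : 0 < l) (sizeE : N + l = n.+1) (b_le : b + l <= n).
Implicit Types (s : 'S_n) (rho : 'S_N) (pi : 'S_l).

(* Collapses the block c, ..., c + l - 1 to the single point c. *)
Definition collapse (c x : nat) : nat := minn x c + (x - (c + l).-1).

(** A section of [collapse] that represents the block by its first point. *)
Definition expand (c y : nat) : nat := if y <= c then y else y + l.-1.

Lemma expandK c : cancel (expand c) (collapse c).
Proof. by rewrite /expand /collapse => y; case: leqP; lia. Qed.

Lemma collapse_block c x : (collapse c x == c) = (c <= x < c + l).
Proof. by rewrite /collapse; lia. Qed.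

Lemma collapse_lt c x : c < N -> (collapse c x < N) = (x < n).
Proof. by rewrite /collapse; lia. Qed.

Lemma collapse_mono c x y :
    ~~ ((c <= x < c + l) && (c <= y < c + l)) ->
  (collapse c x < collapse c y) = (x < y).
Proof. by rewrite /collapse; lia. Qed.

Lemma collapse_inj c x y :
  collapse c x = collapse c y -> x = y \/ (c <= x < c + l) && (c <= y < c + l).
Proof. by rewrite /collapse; lia. Qed.

(** This is the inflation of [rho] by [pi] at the letter [b], which sits at position [a]. The second
    clause can range over all of [nat]: from [n] on the extensions are the identity and both
    collapses subtract [l - 1]. *)
Definition is_inflation (a : nat) rho pi s : Prop :=
  [/\ ext rho a = b,
      forall x, collapse b (ext s x) = ext rho (collapse a x) &
      forall y, y < l -> ext s (a + y) = b + ext pi y].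

Lemma b_ltN : b < N. Proof. lia. Qed.

Section Properties.

Variables (a : nat) (rho : 'S_N) (pi : 'S_l) (s : 'S_n).
Hypothesis infl : is_inflation a rho pi s.

Lemma inflation_pos : a < N.
Proof. by case: infl => rho_a _ _; rewrite -(ext_lt rho) rho_a b_ltN. Qed.

Lemma inflation_block x : (b <= ext s x < b + l) = (a <= x < a + l).
Proof.
case: infl => rho_a sE _.
by rewrite -!collapse_block sE -{1}rho_a (inj_eq (@ext_inj _ _)).
Qed.

Lemma inflation_clustered : s \in clustered n l b.+1.
Proof.
apply/clusteredP=> //; exists a => [|x _]; last exact: inflation_block.
by have := inflation_pos; lia.
Qed.

Lemma inflation_outerE y : ext rho y = collapse b (ext s (expand a y)).
Proof. by case: infl => _ -> _; rewrite expandK. Qed.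

(** Two distinct expanded positions are never both in the window, so collapsing values preserves
    their order. *)
Lemma inflation_outer_lt x y :
  (ext s (expand a x) < ext s (expand a y)) = (ext rho x < ext rho y).
Proof.
have [<-|xy] := eqVneq x y; first by rewrite !ltnn.
rewrite !inflation_outerE collapse_mono // !inflation_block.
by rewrite -!collapse_block !expandK; lia.
Qed.

Lemma contains_outer m (t : 'S_m) : contains t rho -> contains t s.
Proof.
case/containsP=> f [f_lt fP tP]; apply/containsP.
exists (fun j => expand a (f j)); split=> [j|j j' /fP|j j'].
- by rewrite -(@collapse_lt a) ?inflation_pos // expandK.
- by rewrite /expand; case: (leqP (f j) a); case: (leqP (f j') a); lia.
- by rewrite inflation_outer_lt.
Qed.

Lemma contains_inner m (t : 'S_m) : contains t pi -> contains t s.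
Proof.
case/containsP=> f [f_lt fP tP]; apply/containsP.
case: (infl) => _ _ piE; have a_lt := inflation_pos.
exists (fun j => a + f j); split=> [j|j j' /fP|j j'].
- by have := f_lt j; lia.
- by lia.
- by rewrite !piE // ltn_add2l.
Qed.

(** * Occurrences of a pattern in an inflation *)

Section Occurrence.

Variables (m : nat) (t : 'S_m) (f : 'I_m -> nat).
Hypotheses (f_lt : forall j, f j < n).
Hypothesis f_mono : forall j j' : 'I_m, j < j' -> f j < f j'.
Hypothesis f_order : forall j j', (ext s (f j) < ext s (f j')) = (t j < t j').

Definition in_block (j : 'I_m) : bool := a <= f j < a + l.

Lemma occurrence_lt (j j' : 'I_m) : (f j < f j') = (j < j').
Proof.
case: ltngtP (@f_mono j j') (@f_mono j' j) => [|_ _ /(_ isT)|].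
- by move=> _ /(_ isT) ->.
- by lia.
- by move/val_inj->; rewrite ltnn.
Qed.

Lemma in_block_convex (i j h : 'I_m) :
  in_block i -> in_block h -> i <= j <= h -> in_block j.
Proof.
rewrite /in_block => bi bh; rewrite leqNgt [j <= h]leqNgt -!occurrence_lt; lia.
Qed.

Lemma in_block_convex_val (i j h : 'I_m) :
  in_block i -> in_block h -> t i <= t j <= t h -> in_block j.
Proof.
rewrite /in_block -!inflation_block => bi bh.
by rewrite leqNgt [t j <= t h]leqNgt -!f_order; lia.
Qed.

(** If at most one letter lies in the window, collapsing preserves the order of the positions and of
    the values, which gives an occurrence in [rho]. *)
Lemma occurrence_outer :
  contains t rho \/ exists j j', [/\ in_block j, in_block j' & j < j'].
Proof.
have [/existsP[j /existsP[j' /and3P[]]] | /existsPn few] :=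
  boolP [exists j, exists j' : 'I_m, [&& in_block j, in_block j' & j < j']].
  by right; exists j, j'.
left; apply/containsP.
have outside (j j' : 'I_m) : j != j' -> ~~ (in_block j && in_block j').
  rewrite neq_ltn; have /existsPn/(_ j') := few j;
  have /existsPn/(_ j) := few j'.
  by case: (in_block j); case: (in_block j') => //=; clear; lia.
exists (fun j => collapse a (f j)); split=> [j|j j' jj'|j j'].
- by rewrite collapse_lt ?inflation_pos.
- by rewrite collapse_mono ?f_mono // outside // neq_ltn jj'.
have [-> | jj'] := eqVneq j j'; first by rewrite !ltnn.
case: (infl) => _ sE _; rewrite -!sE collapse_mono ?f_order //.
by rewrite !inflation_block outside.
Qed.

Lemma occurrence_inner : (forall j, in_block j) -> contains t pi.
Proof.
move=> all_block; apply/containsP; exists (fun j => f j - a).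
have fE j : f j = a + (f j - a) by have := all_block j; rewrite /in_block; lia.
have f_ltl j : f j - a < l by have := all_block j; rewrite /in_block; lia.
split=> // [j j' /f_mono|j j'].
  by have := all_block j; rewrite /in_block; lia.
rewrite -f_order (fE j) (fE j'); case: (infl) => _ _ piE.
by rewrite !piE // ltn_add2l !addKn.
Qed.

(** The indices whose letters fall in the window form an interval, and so do their values under [t].
    The indices [j1] and [j2] make its size at least 2, and [j3] makes it less than [m]: a forbidden
    cluster. *)
Lemma occurrence_cluster j1 j2 j3 :
    in_block j1 -> in_block j2 -> j1 < j2 -> ~~ in_block j3 ->
  ~ cluster_free t.
Proof.
move=> b1 b2 j12 b3 cf; pose J := [set j | in_block j].
have J1 : j1 \in J by rewrite inE.
have [p pJ JE] : exists2 p, p + #|J| <= m &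
    forall i : 'I_m, (i \in J) = (p <= i < p + #|J|).
  apply: convex_set; first by apply/set0Pn; exists j1.
  by move=> i j h; rewrite !inE; apply: in_block_convex.
have cardtJ : #|t @: J| = #|J| by apply/card_imset/perm_inj.
have [q qJ tJE] : exists2 q, q + #|t @: J| <= m &
    forall i : 'I_m, (i \in t @: J) = (q <= i < q + #|t @: J|).
  apply: convex_set; first by apply/set0Pn; exists (t j1); apply: imset_f.
  move=> i j h; rewrite -(permKV t i) -(permKV t j) -(permKV t h).
  by rewrite !(mem_imset _ _ (@perm_inj _ t)) !inE; apply: in_block_convex_val.
rewrite cardtJ in qJ tJE.
have J_gt1 : 1 < #|J|.
  rewrite (leq_trans _ (subset_leq_card (_ : [set j1; j2] \subset J))) //.
    by rewrite cards2 neq_ltn j12.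
  by apply/subsetP=> j; rewrite !inE => /pred2P[]->.
have J_lt : #|J| < m.
  rewrite -[m in X in _ < X]card_ord -cardsT proper_card // properT.
  by apply: contraNneq b3 => JT; have := in_setT j3; rewrite -JT inE.
have /negP := cf #|J| q.+1 ltac:(lia) isT ltac:(lia); apply.
apply/clusteredP; first by lia.
exists p => // x lx; rewrite -[x]/(val (Ordinal lx)) ext_ord /=.
by rewrite -tJE (mem_imset _ _ (@perm_inj _ t)) JE.
Qed.

(** The flag [e] selects decreasing ([true]) or increasing ([false]) window content. By convexity
    [j1] and its successor [j3] are both in the window, where [t] is monotone; their values are
    consecutive because a value in between would need an index in between. *)
Lemma occurrence_tight (e : bool) j1 j2 :
    (forall x y, x < l -> y < l -> x != y ->
       (ext pi x < ext pi y) = (x < y) (+) e) ->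
    in_block j1 -> in_block j2 -> j1 < j2 ->
  if e then tight21 t else tight12 t.
Proof.
move=> pi_mono b1 b2 j12.
have blockE j j' : in_block j -> in_block j' -> j != j' ->
    (t j < t j') = (j < j') (+) e.
  move=> bj bj' jj'; rewrite -f_order -occurrence_lt.
  have f_neq : f j != f j' by rewrite neq_ltn !occurrence_lt -neq_ltn.
  move: bj bj'; rewrite /in_block => bj bj'.
  have fE : f j = a + (f j - a) by lia.
  have fE' : f j' = a + (f j' - a) by lia.
  by case: (infl) => _ _ piE; rewrite {1}fE {1}fE' !piE ?ltn_add2l ?pi_mono; lia.
have ltj : j1.+1 < m by have := ltn_ord j2; lia.
pose j3 := Ordinal ltj.
have b3 : in_block j3 by apply: (in_block_convex b1 b2) => /=; lia.
have t13 : (t j1 < t j3) = ~~ e by rewrite blockE // /j3 -?val_eqE /=; lia.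
have t31 : (t j3 < t j1) = e by rewrite blockE // /j3 -?val_eqE /=; lia.
have between i j h : in_block j ->
    (i == j1) && (h == j3) || (i == j3) && (h == j1) ->
    ~~ (t i < t j < t h).
  move=> bj ih; apply/negP=> /andP[tij tjh].
  have ij : i != j by apply: contraTneq tij => ->; rewrite ltnn.
  have jh : j != h by apply: contraTneq tjh => ->; rewrite ltnn.
  case/orP: ih ij jh tij tjh => /andP[/eqP-> /eqP->] ij jh;
    rewrite !blockE //; move: ij jh; rewrite -!val_eqE /=; clear.
    by case: e; lia.
  by case: e; lia.
(* The index carrying the value [(t i).+1] is in the window by convexity of values, so [between]
   forces that value to be [t h]. *)
have succ i h : (i == j1) && (h == j3) || (i == j3) && (h == j1) ->
    t i < t h -> t h == (t i).+1 :> nat.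
  move=> ih tih; have lv : (t i).+1 < m := leq_ltn_trans tih (ltn_ord _).
  set j := t^-1%g (Ordinal lv); have tj : t j = (t i).+1 :> nat by rewrite permKV.
  have [bi bh] : in_block i /\ in_block h.
    by case/orP: ih => /andP[/eqP-> /eqP->].
  have bj : in_block j by apply: (in_block_convex_val bi bh); rewrite tj leqnSn.
  have := between i j h bj ih; rewrite tj leqnn /= -leqNgt => thi.
  by rewrite eqn_leq thi.
have [et | et] := boolP e; apply/existsP; exists j1; apply/existsP; exists j3.
  by rewrite eqxx /= succ ?eqxx ?orbT ?t31.
by rewrite eqxx /= succ ?eqxx ?t13.
Qed.

End Occurrence.

Lemma contains_cluster_free m (t : 'S_m) :
  cluster_free t -> contains t s -> contains t rho || contains t pi.
Proof.
move=> cf /containsP[f [f_lt f_mono f_order]].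
case: (occurrence_outer f_lt f_mono f_order) => [-> // | [j [j' [bj bj' jj']]]].
have [/forallP all_block | /forallPn[j3 b3]] := boolP [forall j, in_block f j].
  by rewrite (occurrence_inner f_mono f_order) ?orbT.
by case: (occurrence_cluster f_mono f_order bj bj' jj' b3 cf).
Qed.

Lemma contains_tight (e : bool) m (t : 'S_m) :
    (forall x y, x < l -> y < l -> x != y ->
       (ext pi x < ext pi y) = (x < y) (+) e) ->
    contains t s ->
  contains t rho || (if e then tight21 t else tight12 t).
Proof.
move=> pi_mono /containsP[f [f_lt f_mono f_order]].
case: (occurrence_outer f_lt f_mono f_order) => [-> // | [j [j' [bj bj' jj']]]].
by rewrite (occurrence_tight f_mono f_order pi_mono bj bj') ?orbT.
Qed.

End Properties.

(** * The bijection between clustered permutations and pairs *)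

Lemma inflation_uniq_parts a a' rho rho' pi pi' s :
    is_inflation a rho pi s -> is_inflation a' rho' pi' s ->
  (rho, pi) = (rho', pi').
Proof.
move=> I I'; have aa' : a = a'.
  have := inflation_block I a; rewrite (inflation_block I').
  by have := inflation_block I a'; rewrite (inflation_block I'); lia.
rewrite -{a'}aa' in I'; congr pair; apply: eq_ext => x lx.
  by rewrite (inflation_outerE I) (inflation_outerE I').
case: I I' => _ _ piE [_ _ piE']; apply/(@addnI b).
by rewrite -(piE _ lx) -(piE' _ lx).
Qed.

(** The position of [b] in [rho] fixes the window. Inside it [pi] gives the values; outside it they
    are recovered because [collapse] only identifies points of the block. *)
Lemma inflation_uniq a a' rho pi s s' :
  is_inflation a rho pi s -> is_inflation a' rho pi s' -> s = s'.
Proof.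
move=> I I'; have aa' : a = a'.
  by case: I I' => rho_a _ _ [rho_a' _ _]; apply: (@ext_inj _ rho); lia.
rewrite -{a'}aa' in I'; apply: eq_ext => x lx.
case: (I) (I') => _ sE piE [_ sE' piE'].
have := sE x; rewrite -sE' => /collapse_inj[//|/andP[]].
rewrite (inflation_block I) => xa _.
have xal : x - a < l by lia.
have -> : x = a + (x - a) by lia.
by rewrite (piE _ xal) (piE' _ xal).
Qed.

Lemma inflation_exists rho pi : exists s, is_inflation (ext rho^-1 b) rho pi s.
Proof.
set a := ext rho^-1 b; have rho_a : ext rho a = b by rewrite extKV.
have a_lt : a < N by rewrite ext_lt b_ltN.
pose f x := if a <= x < a + l then b + ext pi (x - a)
            else expand b (ext rho (collapse a x)).
(* Both the range and the injectivity of [f] follow from this identity, except for collisions inside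
   the window, which the injectivity of [pi] excludes. *)
have fE x : collapse b (f x) = ext rho (collapse a x).
  rewrite /f; case: ifP => [xa|_]; last by rewrite expandK.
  have := xa; rewrite -collapse_block => /eqP->; rewrite rho_a.
  by apply/eqP; rewrite collapse_block; have := ext_lt pi (x - a); lia.
have f_lt x : (f x < n) = (x < n).
  by rewrite -(collapse_lt _ b_ltN) fE ext_lt collapse_lt.
have [||s sE] := @ext_exists n f.
- by move=> x; rewrite f_lt.
- move=> x y _ _ fxy; have := fE x; rewrite fxy fE => /ext_inj/esym.
  case/collapse_inj=> // /andP[xa ya]; move: fxy; rewrite /f xa ya.
  by move/addnI/ext_inj; lia.
exists s; split=> // [x | y ly].
  case: (ltnP x n) => [/sE-> // | nx]; rewrite (ext_out _ nx) ext_out.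
    by rewrite /collapse; lia.
  by rewrite leqNgt collapse_lt // -leqNgt.
rewrite sE ?/f; last by lia.
by have [-> ->] : (a <= a + y < a + l) = true /\ a + y - a = y by lia.
Qed.

(** Here [rho] is [s] read through [expand] on positions and [collapse] on values, and [pi] is the
    window content shifted down by [b]. *)
Lemma clustered_inflation s : s \in clustered n l b.+1 ->
  exists a rho pi, is_inflation a rho pi s.
Proof.
case/clusteredP=> // a al_n sE.
have a_lt : a < N by lia.
have block x : (b <= ext s x < b + l) = (a <= x < a + l).
  by case: (ltnP x n) => [/sE // | nx]; rewrite ext_out //; lia.
have blockE x : (collapse b (ext s x) == b) = (collapse a x == a).
  by rewrite !collapse_block block.
have [||rho rhoE] := @ext_exists N (fun y => collapse b (ext s (expand a y))).
- move=> y ly; rewrite collapse_lt ?b_ltN // ext_lt -(collapse_lt _ a_lt).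
  by rewrite expandK.
- move=> x y _ _ /collapse_inj[/ext_inj/(can_inj (expandK a)) //|].
  by rewrite !block -!collapse_block !expandK => /andP[/eqP-> /eqP->].
have [||pi piE] := @ext_exists l (fun y => ext s (a + y) - b).
- by move=> y ly; have := block (a + y); lia.
- move=> x y lx ly xy; apply/(@addnI a)/(@ext_inj _ s).
  by have := block (a + x); have := block (a + y); lia.
exists a, rho, pi; split=> [|x|y ly].
- rewrite rhoE //; apply/eqP; rewrite blockE; apply/eqP.
  by rewrite /expand leqnn /collapse; lia.
- case: (ltnP x n) => [lx | nx]; last first.
    rewrite (ext_out _ nx) ext_out; first by rewrite /collapse; lia.
    by rewrite leqNgt collapse_lt // -leqNgt.
  rewrite rhoE ?collapse_lt //.
  (* In the window both sides equal [b]; outside it, [expand] undoes [collapse]. *)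
  have [/eqP xa|xa] := boolP (collapse a x == a).
    have /eqP-> : collapse b (ext s x) == b by rewrite blockE xa.
    by apply/esym/eqP; rewrite blockE expandK xa.
  congr (collapse b (ext s _)); rewrite /expand; case: ifP; rewrite /collapse in xa *; lia.
- by rewrite piE //; have := block (a + y); lia.
Qed.

Lemma inflate_exists : exists2 inflate : 'S_N * 'S_l -> 'S_n,
  injective inflate &
  forall p, is_inflation (ext p.1^-1 b) p.1 p.2 (inflate p).
Proof.
have [inflate inflateP] := fin_all_exists (fun p : 'S_N * 'S_l =>
  inflation_exists p.1 p.2).
exists inflate => // -[rho pi] [rho' pi'] pp'; have := inflateP (rho, pi).
by rewrite pp' => I; apply: inflation_uniq_parts I (inflateP (rho', pi')).
Qed.

(** * Counting clustered avoiders *)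

Lemma card_clustered_avoiders_le m (t : 'S_m) :
  #|clustered n l b.+1 :&: avoiders t n| <= #|avoiders t N| * #|avoiders t l|.
Proof.
have [inflate inflate_inj inflateP] := inflate_exists.
rewrite -cardsX -(card_imset _ inflate_inj); apply/subset_leq_card/subsetP=> s.
rewrite inE => /andP[/clustered_inflation[a [rho [pi I]]]]; rewrite inE => av_s.
have -> : s = inflate (rho, pi) by apply: inflation_uniq I (inflateP (rho, pi)).
apply: imset_f; rewrite !inE /=.
rewrite (contra (@contains_outer _ _ _ _ I _ t)) //.
by rewrite (contra (@contains_inner _ _ _ _ I _ t)).
Qed.

(** The set [B] of admissible window contents is the parameter that unifies the lower bounds: all
    avoiders for (ii), and the identity, the reversal or both for (iii). *)
Lemma card_clustered_avoiders_ge m (t : 'S_m) (B : {set 'S_l}) :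
    (forall a rho pi s, is_inflation a rho pi s -> pi \in B ->
       contains t s -> contains t rho) ->
  #|avoiders t N| * #|B| <= #|clustered n l b.+1 :&: avoiders t n|.
Proof.
move=> avB; have [inflate inflate_inj inflateP] := inflate_exists.
rewrite -cardsX -(card_imset _ inflate_inj).
apply/subset_leq_card/subsetP=> s /imsetP[[rho pi]].
rewrite inE /= inE => /andP[av_rho Bpi] ->; have I := inflateP (rho, pi).
rewrite inE (inflation_clustered I) inE /=.
by apply: contra av_rho; apply: avB I Bpi.
Qed.

Lemma contains_tight12 a rho s m (t : 'S_m) :
  ~~ tight12 t -> is_inflation a rho 1%g s -> contains t s -> contains t rho.
Proof.
move=> /negPf t12 I /(contains_tight I (e := false)); rewrite t12 orbF; apply.
by move=> x y _ _ _; rewrite !ext1 addbF.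
Qed.

Lemma contains_tight21 a rho s m (t : 'S_m) :
  ~~ tight21 t -> is_inflation a rho (rev_perm l) s -> contains t s -> contains t rho.
Proof.
move=> /negPf t21 I /(contains_tight I (e := true)); rewrite t21 orbF; apply.
by move=> x y lx ly xy; rewrite !ext_rev //; lia.
Qed.

End Inflation.

Theorem theorem1 (m : nat) (hm : (2 <= m)%N) (t : 'S_m)
    (n l k : nat) (hn : (3 <= n)%N) (hl : (2 <= l <= n - 1)%N)
    (hk : (1 <= k)%N) (hkl : (k + l - 1 <= n)%N) :
  [/\ (* (i) *)
      (Pav t (clustered n l k)
         <= #|avoiders t (n - l + 1)|%:R * #|avoiders t l|%:R
            / #|avoiders t n|%:R)%R,
      (* (ii) *)
      cluster_free t ->
      (Pav t (clustered n l k)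
         = #|avoiders t (n - l + 1)|%:R * #|avoiders t l|%:R
           / #|avoiders t n|%:R)%R,
      (* (iii), first part *)
      ~~ tight12 t \/ ~~ tight21 t ->
      (Pav t (clustered n l k)
         >= #|avoiders t (n - l + 1)|%:R / #|avoiders t n|%:R)%R
    & (* (iii), second part *)
      ~~ tight12 t /\ ~~ tight21 t ->
      (Pav t (clustered n l k)
         >= 2%:R * #|avoiders t (n - l + 1)|%:R / #|avoiders t n|%:R)%R].
Proof.
case: k hk hkl => // b _ hbl.
have l_gt1 : 1 < l by lia.
have l_gt0 := ltnW l_gt1.
have sizeE : (n - l + 1) + l = n.+1 by lia.
have b_le : b + l <= n by lia.
have le_div (x y : nat) : x <= y ->
    (x%:R / #|avoiders t n|%:R <= y%:R / #|avoiders t n|%:R :> rat)%R.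
  by move=> xy; rewrite ler_wpM2r ?invr_ge0 ?ler0n // ler_nat.
have le_card := card_clustered_avoiders_le l_gt0 sizeE b_le t.
have ge_card := card_clustered_avoiders_ge l_gt0 sizeE b_le (t := t).
rewrite /Pav -!natrM; split.
- exact: le_div.
- move=> cf; congr (_%:R / _)%R; apply/eqP; rewrite eqn_leq le_card /=.
  (* Here [B] is [avoiders t l], so an occurrence in [pi] is ruled out. *)
  apply: ge_card => a rho pi s I; rewrite inE => /negPf av_pi.
  by move/(contains_cluster_free l_gt0 sizeE b_le I cf); rewrite av_pi orbF.
- case=> tight; apply: le_div.
    have := ge_card [set 1%g]; rewrite cards1 muln1.
    apply=> a rho pi s I /set1P pi1; rewrite pi1 in I.
    exact: contains_tight12 I.
  have := ge_card [set rev_perm l]; rewrite cards1 muln1.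
  apply=> a rho pi s I /set1P pi_rev; rewrite pi_rev in I.
  exact: contains_tight21 I.
- case=> no12 no21; apply: le_div.
  have := ge_card [set 1%g; rev_perm l].
  (* The factor 2 arises because the identity and the reversal differ when [l > 1]. *)
  rewrite cards2 rev_perm_neq1 // mulnC; apply=> a rho pi s I.
  case/set2P=> piE; rewrite piE in I; first exact: contains_tight12 I.
  exact: contains_tight21 I.
Qed.
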